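(* Let $\beta>0$ and let $H:\mathbb{R}\to[0,\infty]$ be such that $e^{-H(x)}$ is a distribution function on $\mathbb{R}$. Let $\{Y(t),t\ge0\}$ be an extremal process having homogeneous max-increments with distribution function $e^{-H(x)}$, and let $\{T(t),t\ge0\}$ be an independent compounding process which is G-gamma($\beta$), i.e. $T(1)$ has Laplace transform $\dfrac{1}{1+\log\big((1+\lambda)^{\beta}\big)}$, $\lambda\ge0$. Then the random time changed extremal process $\{Y(T(t))\}$ is G-gamma-MID($\beta$), i.e. $Y(T(1))$ has distribution function $\dfrac{1}{1+\beta\log(1+H(x))}$.
   Context: Conventions: $e^{-\infty}=0$, $1/\infty=0$, $\log\infty=\infty$. An extremal process (EP) is a process with increasing right-continuous sample paths and independent max-increments; its univariate marginals determine its finite-dimensional distributions. An EP $Y$ has homogeneous max-increments with distribution function $F$ if for each $t>0$ the variable $Y(t)$ has distribution function $F^{t}$. An EP is referred to by the name of the distribution of its (unit-time) max-increments, i.e. the law of its value at $t=1$. A compounding process for $Y$ is a non-negative process $\{T(t),t\ge0\}$, independent of $Y$, with stationary, independent, additive increments; it is referred to by the name of the law of $T(1)$. The compound (random time changed) EP is $Y(T(t))$, which is again an EP. The geometric gamma law G-gamma($\beta$), $\beta>0$, is the law on $[0,\infty)$ with Laplace transform $\dfrac{1}{1+\log((1+\lambda)^{\beta})}=\dfrac{1}{1+\beta\log(1+\lambda)}$. For $\psi:\mathbb{R}\to[0,\infty]$ with $e^{-\psi}$ a distribution function, the G-gamma-MID($\beta$) law associated with $\psi$ has distribution function $\dfrac{1}{1+\beta\log(1+\psi(x))}$.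 *)

(* Defs.v *)
From HB Require Import structures.
From mathcomp Require Import all_boot all_order all_algebra.
From mathcomp Require Import all_classical all_reals all_analysis.
From mathcomp Require Import measurable_realfun.

Set Implicit Arguments.
Unset Strict Implicit.
Unset Printing Implicit Defensive.

Import Order.TTheory GRing.Theory Num.Theory.
Import numFieldNormedType.Exports.

Local Open Scope classical_set_scope.
Local Open Scope ring_scope.
Local Open Scope ereal_scope.

(* Processes indexed by [0, +oo[ are functions of t : R; every condition below
   only concerns the times t >= 0.

   Extremal processes take values in \bar R: if F > 0 everywhere, then
   Y(0) = lim_(t -> 0+) Y(t) is almost surely -oo, so that no real-valued
   process on [0, +oo[ has increasing paths and marginals F^t. *)

Definition process d (Omega : measurableType d) d' (S : measurableType d')
    (R : realType) (X : R -> Omega -> S) : Prop :=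
  forall t, (0 <= t)%R -> measurable_fun [set: Omega] (X t).

Definition eq_in_law d1 (O1 : measurableType d1) d2 (O2 : measurableType d2)
    d' (S : measurableType d') (R : realType)
    (P : probability O1 R) (Q : probability O2 R)
    (X : O1 -> S) (Z : O2 -> S) : Prop :=
  forall B, measurable B -> P (X @^-1` B) = Q (Z @^-1` B).

(* Subfamilies are covered by taking B i = setT. *)
Definition mutually_independent d (Omega : measurableType d)
    d' (S : measurableType d') (R : realType) (P : probability Omega R)
    (n : nat) (X : 'I_n -> Omega -> S) : Prop :=
  forall B : 'I_n -> set S, (forall i, measurable (B i)) ->
    P (\bigcap_i (X i @^-1` B i)) = \prod_(i < n) P (X i @^-1` B i).

Definition generated_sigma d (Omega : measurableType d)
    d' (S : measurableType d') (R : realType) (X : R -> Omega -> S) :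
    set (set Omega) :=
  <<s \bigcup_(t in [set t : R | (0 <= t)%R])
        preimage_set_system [set: Omega] (X t) measurable >>.

Definition independent_processes d (Omega : measurableType d)
    d1 (S1 : measurableType d1) d2 (S2 : measurableType d2)
    (R : realType) (P : probability Omega R)
    (X : R -> Omega -> S1) (Z : R -> Omega -> S2) : Prop :=
  forall A B, generated_sigma X A -> generated_sigma Z B ->
    P (A `&` B) = P A * P B.

Definition distribution_function (R : realType) (F : R -> \bar R) : Prop :=
  [/\ {homo F : x y / (x <= y)%R >-> x <= y},
      right_continuous F,
      F x @[x --> -oo%R] --> (0 : \bar R)
    & F x @[x --> +oo%R] --> (1 : \bar R)].

Definition has_df d (Omega : measurableType d) (R : realType)
    (P : probability Omega R) (X : Omega -> \bar R) (F : R -> \bar R) : Prop :=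
  measurable_fun [set: Omega] X /\
  forall x : R, P [set w | X w <= x%:E] = F x.

(* For 0 <= t_0 < ... < t_n there are independent U_0, ..., U_n, possibly on
   another probability space, such that (Y(t_0), ..., Y(t_n)) has the law of
   (U_0, U_0 v U_1, ..., U_0 v ... v U_n). *)
Definition independent_max_increments d (Omega : measurableType d)
    (R : realType) (P : probability Omega R) (Y : R -> Omega -> \bar R) : Prop :=
  forall (n : nat) (t : nat -> R),
    (0 <= t 0%N)%R -> {homo t : i j / (i < j)%N >-> (i < j)%R} ->
    exists (d' : measure_display) (Omega' : measurableType d')
           (Q : probability Omega' R) (U : 'I_n.+1 -> Omega' -> \bar R),
      [/\ forall i, measurable_fun [set: Omega'] (U i),
          mutually_independent Q U
        & eq_in_law P Q
            (fun w => [tuple Y (t i) w | i < n.+1])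
            (fun w => [tuple \big[maxe/-oo]_(j < n.+1 | (j <= i)%N) U j w
                      | i < n.+1])].

Definition extremal_process d (Omega : measurableType d) (R : realType)
    (P : probability Omega R) (Y : R -> Omega -> \bar R) : Prop :=
  [/\ process Y,
      forall w (s t : R), (0 <= s)%R -> (s <= t)%R -> Y s w <= Y t w,
      forall w (t : R), (0 <= t)%R -> Y s w @[s --> t^'+] --> Y t w
    & independent_max_increments P Y].

Definition homogeneous_max_increments d (Omega : measurableType d)
    (R : realType) (P : probability Omega R)
    (Y : R -> Omega -> \bar R) (F : R -> \bar R) : Prop :=
  forall t : R, (0 < t)%R -> has_df P (Y t) (fun x => F x `^ t).

Definition stationary_increments d (Omega : measurableType d) (R : realType)
    (P : probability Omega R) (T : R -> Omega -> R) : Prop :=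
  forall s t h : R, (0 <= s)%R -> (s <= t)%R -> (0 <= h)%R ->
    eq_in_law P P (fun w => T (t + h)%R w - T (s + h)%R w)%R
                  (fun w => T t w - T s w)%R.

Definition independent_increments d (Omega : measurableType d) (R : realType)
    (P : probability Omega R) (T : R -> Omega -> R) : Prop :=
  forall (n : nat) (t : nat -> R),
    (0 <= t 0%N)%R -> {homo t : i j / (i < j)%N >-> (i < j)%R} ->
    mutually_independent P
      (fun (i : 'I_n) w => T (t i.+1) w - T (t i) w)%R.

Definition compounding_process d (Omega : measurableType d) (R : realType)
    (P : probability Omega R)
    (Y : R -> Omega -> \bar R) (T : R -> Omega -> R) : Prop :=
  [/\ process T,
      forall w (t : R), (0 <= t)%R -> (0 <= T t w)%R,
      stationary_increments P T,
      independent_increments P T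
    & independent_processes P Y T].

Definition laplace_transform d (Omega : measurableType d) (R : realType)
    (P : probability Omega R) (X : Omega -> R) (l : R) : \bar R :=
  'E_P[fun w => expR (- (l * X w))].

Definition G_gamma d (Omega : measurableType d) (R : realType)
    (P : probability Omega R) (beta : R) (X : Omega -> R) : Prop :=
  [/\ measurable_fun [set: Omega] X,
      P (X @^-1` `[0%R, +oo[) = 1
    & forall l : R, (0 <= l)%R ->
        laplace_transform P X l = (1 / (1 + ln ((1 + l) `^ beta)))%R%:E].

Definition time_change (Omega : Type) (R : realType)
    (Y : R -> Omega -> \bar R) (T : R -> Omega -> R) : R -> Omega -> \bar R :=
  fun t w => Y (T t w) w.

(* lne and the inverse on \bar R satisfy lne +oo = +oo and +oo^-1 = 0, so this
   is 0 where psi x = +oo. *)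
Definition G_gamma_MID_df (R : realType) (beta : R) (psi : R -> \bar R) :
    R -> \bar R :=
  fun x => 1 / (1 + beta%:E * lne (1 + psi x)).

(* An extremal process is named after the law of its value at time 1. *)
Definition G_gamma_MID d (Omega : measurableType d) (R : realType)
    (P : probability Omega R) (beta : R) (psi : R -> \bar R)
    (Z : R -> Omega -> \bar R) : Prop :=
  has_df P (Z 1%R) (G_gamma_MID_df beta psi).

(* Main.v *)
Require Import Defs.
From mathcomp Require Import all_boot all_order all_algebra.
From mathcomp Require Import all_classical all_reals all_analysis.
From mathcomp Require Import measurable_realfun.
Import Order.TTheory GRing.Theory Num.Theory.
Import numFieldNormedType.Exports.

(**
Conditioning on T(1), which is independent of Y, gives
  P (Y (T(1)) <= x) = E [exp (- H(x) T(1))],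
the Laplace transform of T(1) at H(x), which is 1 / (1 + beta log (1 + H(x))).

The conditioning is made elementary by cutting the range of X = T(1) into the
cells [k e, (k + 1) e[. On such a cell the increasing process Y at time X is
squeezed between Y (k e) and Y ((k + 1) e), each independent of the event that X
lies in the cell, and exp (- h X) is known up to the factor exp (- h e). Summing
over k and letting e tend to 0 yields the two one-sided comparisons
[time_change_df_le_laplace] and [time_change_df_ge_laplace]: a bound of
P (Y t <= x) by exp (- h t), for all t, passes to a bound of P (Y (X) <= x) by
the Laplace transform of X at h. Both apply with h = H(x) when H(x) is finite.
When H(x) is infinite the first one applies for every h, and the transform of
T(1) tends to 0 at infinity; in particular no information on Y(0) is needed,
although T(1) might vanish on a null event.

That Y (X) is a random variable follows from right-continuity of the paths
([measurable_time_change]): Y (X) < a if and only if Y q < a for some rational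
q > X.
*)

Set Implicit Arguments.
Unset Strict Implicit.
Unset Printing Implicit Defensive.

Local Open Scope classical_set_scope.
Local Open Scope ring_scope.
Local Open Scope ereal_scope.

(** Letting e tend to 0 in exp (- h e) a <= b. *)
Lemma le_of_expRN_mul (R : realType) (h : R) (a b : \bar R) :
  (0 <= h)%R -> 0 <= a ->
  (forall e : R, (0 < e)%R -> (expR (- (h * e)))%:E * a <= b) -> a <= b.
Proof.
move=> h0; case: a => [a||//] a0 hab; last first.
  by have := hab 1%R ltr01; rewrite gt0_muley// lte_fin expR_gt0.
case: b hab => [b||] hab; [|by rewrite leey|by have := hab 1%R ltr01].
rewrite lee_fin in a0; apply/lee_addgt0Pr => e e0; rewrite -EFinD lee_fin.
have ha1 : (0 < h * a + 1)%R by rewrite ltr_wpDl// mulr_ge0.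
have := hab (e / (h * a + 1))%R (divr_gt0 e0 ha1).
rewrite -EFinM lee_fin => /(le_trans _) {}hab.
(* exp (- u) >= 1 - u with u = h e / (h a + 1), so that u a <= e. *)
have {}hab : ((1 - h * (e / (h * a + 1))) * a <= b)%R.
  by apply: hab; rewrite ler_wpM2r// expR_ge1Dx.
have : (h * (e / (h * a + 1)) * a <= e)%R.
  rewrite (_ : _ * a = e * (h * a) / (h * a + 1))%R; last first.
    by rewrite mulrA mulrAC -!mulrA mulrCA !mulrA mulrAC.
  by rewrite ler_pdivrMr// ler_wpM2l ?(ltW e0)// lerDl.
move: hab; rewrite mulrBl mul1r lerBlDr => hab ?.
by rewrite (le_trans hab)// lerD2l.
Qed.

(** * Slicing a random time *)

(** The event that the random time X lies in the k-th cell of the grid of mesh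
    e. *)
Definition slice (Omega : Type) (R : realType) (X : Omega -> R) (e : R)
  (k : nat) : set Omega := X @^-1` `[(k%:R * e)%R, (k.+1%:R * e)%R[.

Section slices.
Context d (Omega : measurableType d) (R : realType) (P : probability Omega R).
Variable X : Omega -> R.
Hypotheses (mX : measurable_fun [set: Omega] X) (X0 : forall w, (0 <= X w)%R).
Variable e : R.
Hypothesis e0 : (0 < e)%R.
Local Notation cell := (@slice Omega R X e).

Lemma measurable_slice k : measurable (cell k).
Proof. by rewrite -[cell k]setTI; apply: mX => //; exact: measurable_itv. Qed.

Lemma sliceP k w : cell k w <-> Num.truncn (X w / e) = k.
Proof.
have Xe0 : (0 <= X w / e)%R by rewrite divr_ge0// ltW.
rewrite /slice /= in_itv /= -ler_pdivlMr// -ltr_pdivrMr//.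
by rewrite -truncn_eq//; split => /eqP.
Qed.

Lemma trivIset_slice : trivIset setT cell.
Proof. by move=> i j _ _ [w [/sliceP <- /sliceP <-]]. Qed.

Lemma bigcup_slice : \bigcup_k cell k = setT.
Proof.
apply/seteqP; split=> // w _.
by exists (Num.truncn (X w / e)) => //; exact/sliceP.
Qed.

Lemma probability_slices A : measurable A ->
  P A = \sum_(0 <= k <oo) P (A `&` cell k).
Proof.
move=> mA; rewrite -{1}(setIT A) -bigcup_slice setI_bigcupr measure_bigcup.
- by apply: eq_eseriesl => k; rewrite in_setT.
- by move=> k _; apply: measurableI => //; exact: measurable_slice.
- by apply: trivIset_setIl; exact: trivIset_slice.
Qed.

Let measurable_expRX h D : measurable D ->
  measurable_fun D (fun w => (expR (- (h * X w)))%:E).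
Proof.
move=> mD; apply/measurable_EFinP/measurableT_comp => //.
apply: measurableT_comp => //; apply: measurable_funM => //.
exact: measurable_funS mX.
Qed.

Lemma laplace_transform_slices h :
  laplace_transform P X h =
  \sum_(0 <= k <oo) \int[P]_(w in cell k) (expR (- (h * X w)))%:E.
Proof.
rewrite /laplace_transform expectation.unlock -bigcup_slice.
rewrite ge0_integral_bigcup//.
- exact: measurable_slice.
- by rewrite bigcup_slice; exact: measurable_expRX.
- exact: trivIset_slice.
Qed.

Lemma le_integral_slice h k : (0 <= h)%R ->
  (expR (- (h * (k.+1%:R * e))))%:E * P (cell k) <=
  \int[P]_(w in cell k) (expR (- (h * X w)))%:E.
Proof.
move=> h0; rewrite -integral_cst; last exact: measurable_slice.
apply: ge0_le_integral.
- exact: measurable_slice.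
- by move=> w _; rewrite lee_fin expR_ge0.
- exact: measurable_cst.
- exact/measurable_expRX/measurable_slice.
- move=> w; rewrite /slice /= in_itv /= => /andP[_ /ltW Xw].
  by rewrite lee_fin ler_expR lerN2 ler_wpM2l.
Qed.

Lemma ge_integral_slice h k : (0 <= h)%R ->
  \int[P]_(w in cell k) (expR (- (h * X w)))%:E <=
  (expR (- (h * (k%:R * e))))%:E * P (cell k).
Proof.
move=> h0; rewrite -integral_cst; last exact: measurable_slice.
apply: ge0_le_integral.
- exact: measurable_slice.
- by move=> w _; rewrite lee_fin expR_ge0.
- exact/measurable_expRX/measurable_slice.
- exact: measurable_cst.
- move=> w; rewrite /slice /= in_itv /= => /andP[Xw _].
  by rewrite lee_fin ler_expR lerN2 ler_wpM2l.
Qed.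

End slices.

(** * Increasing processes at a random time *)

Lemma measurable_time_change d (Omega : measurableType d) (R : realType)
    (Y : R -> Omega -> \bar R) (X : Omega -> R) :
  process Y ->
  (forall w (s t : R), (0 <= s)%R -> (s <= t)%R -> Y s w <= Y t w) ->
  (forall w (t : R), (0 <= t)%R -> Y s w @[s --> t^'+] --> Y t w) ->
  measurable_fun [set: Omega] X -> (forall w, (0 <= X w)%R) ->
  measurable_fun [set: Omega] (fun w => Y (X w) w).
Proof.
move=> mY ndY rcY mX X0.
apply: (measurability _ (ErealGenInftyO.measurableE R)) => _ /= -[_ [a ->] <-].
rewrite setTI.
(* Y at the random time X is the infimum of the Y q over the rationals q > X. *)
rewrite (_ : _ @^-1` _ = \bigcup_(q : rat)
    (X @^-1` `]-oo, ratr q[ `&` Y (Num.max (ratr q) 0%R) @^-1` `]-oo, a%:E[)).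
  apply: bigcupT_measurable_rat => q.
  apply: measurableI.
    by rewrite -[W in measurable W]setTI; apply: mX => //; exact: measurable_itv.
  rewrite -[W in measurable W]setTI; apply: mY; rewrite ?le_max ?lexx ?orbT//.
  exact: emeasurable_itv.
apply/seteqP; split => [w|w [q _]]; rewrite /= !in_itv /=.
  move=> Yw; have : \forall s \near (X w)^'+, Y s w < a%:E.
    exact: (rcY w (X w) (X0 w) _ (open_ereal_lt_ereal Yw)).
  rewrite near_withinE => -[r /= r0 rY].
  have [q] := @rat_in_itvoo R (X w) (X w + r)%R ltac:(by rewrite ltrDl).
  rewrite in_itv /= => /andP[Xq qr].
  exists q => //=; rewrite !in_itv /=; split=> //.
  rewrite max_l; last by rewrite (le_trans (X0 w))// ltW.
  by apply: rY => //=; rewrite ltr0_norm ?subr_lt0// opprB ltrBlDl.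
move=> [Xq]; apply: le_lt_trans; apply: ndY => //.
by rewrite le_max (ltW Xq).
Qed.

Lemma measurable_sublevel d (Omega : measurableType d) (R : realType)
    (f : Omega -> \bar R) (x : R) :
  measurable_fun [set: Omega] f -> measurable [set w | f w <= x%:E].
Proof.
move=> mf; rewrite (_ : [set w | _] = f @^-1` `]-oo, x%:E]).
  by rewrite -[W in measurable W]setTI; apply: mf => //; exact: emeasurable_itv.
by apply/seteqP; split=> w /=; rewrite in_itv.
Qed.

Section time_change_df.
Context d (Omega : measurableType d) (R : realType) (P : probability Omega R).
Variables (Y : R -> Omega -> \bar R) (X : Omega -> R).
Hypothesis mY : process Y.
Hypothesis ndY :
  forall w (s t : R), (0 <= s)%R -> (s <= t)%R -> Y s w <= Y t w.
Hypotheses (mX : measurable_fun [set: Omega] X) (X0 : forall w, (0 <= X w)%R).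
Hypothesis mYX : measurable_fun [set: Omega] (fun w => Y (X w) w).
Hypothesis indep : forall (t x : R) (B : set R), (0 <= t)%R -> measurable B ->
  P ([set w | Y t w <= x%:E] `&` X @^-1` B) =
  P [set w | Y t w <= x%:E] * P (X @^-1` B).

(** On the cell [k e, (k + 1) e[ of X, the event Y (X) <= x implies
    Y (k e) <= x, whose probability is at most exp (- h k e) even given the
    cell, while exp (- h X) is at least exp (- h (k + 1) e). Allowing t = 0 in
    the bound is harmless, as the right-hand side is then 1. *)
Lemma time_change_df_le_laplace (x h : R) : (0 <= h)%R ->
  (forall t : R, (0 <= t)%R ->
    P [set w | Y t w <= x%:E] <= (expR (- (h * t)))%:E) ->
  P [set w | Y (X w) w <= x%:E] <= laplace_transform P X h.
Proof.
move=> h0 Yh; apply: (le_of_expRN_mul h0) => // e e0.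
rewrite (laplace_transform_slices P mX X0 e0).
rewrite (probability_slices P mX X0 e0); last exact: measurable_sublevel.
rewrite -nneseriesZl//; apply: lee_nneseries => [k _ _|k _].
  by rewrite mule_ge0// lee_fin expR_ge0.
have ke0 : (0 <= k%:R * e)%R by rewrite mulr_ge0// ltW.
apply: (le_trans _ (le_integral_slice P mX e k h0)).
rewrite -[(k.+1)%:R%R]nat1r mulrDl mul1r mulrDr opprD expRD EFinM -muleA.
rewrite lee_wpmul2l ?lee_fin ?expR_ge0//.
apply: (@le_trans _ _ (P ([set w | Y (k%:R * e)%R w <= x%:E] `&` slice X e k))).
  apply: le_measure; rewrite ?inE.
  - by apply: measurableI; [exact: measurable_sublevel|exact: measurable_slice].
  - apply: measurableI; last exact: measurable_slice.
    exact/measurable_sublevel/mY.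
  - move=> w [/= Yw Xw]; split=> //=; apply: le_trans Yw; apply: ndY => //.
    by move: Xw; rewrite /slice /= in_itv /= => /andP[].
by rewrite indep// lee_wpmul2r// Yh.
Qed.

(** The reverse bound compares Y (X) with Y at the right end (k + 1) e of the
    cell, so that only times t > 0 occur. *)
Lemma time_change_df_ge_laplace (x h : R) : (0 <= h)%R ->
  (forall t : R, (0 < t)%R ->
    (expR (- (h * t)))%:E <= P [set w | Y t w <= x%:E]) ->
  laplace_transform P X h <= P [set w | Y (X w) w <= x%:E].
Proof.
move=> h0 Yh.
have int0 k e : 0 <= \int[P]_(w in slice X e k) (expR (- (h * X w)))%:E.
  by apply: integral_ge0 => w _; rewrite lee_fin expR_ge0.
apply: (le_of_expRN_mul h0) => [|e e0].
  by rewrite (laplace_transform_slices P mX X0 ltr01) nneseries_ge0.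
rewrite (laplace_transform_slices P mX X0 e0).
rewrite (probability_slices P mX X0 e0); last exact: measurable_sublevel.
rewrite -nneseriesZl//; apply: lee_nneseries => [k _ _|k _].
  by rewrite mule_ge0// lee_fin expR_ge0.
have ke0 : (0 < k.+1%:R * e)%R by rewrite mulr_gt0.
apply: (@le_trans _ _
    (P ([set w | Y (k.+1%:R * e)%R w <= x%:E] `&` slice X e k))).
  rewrite indep ?(ltW ke0)//.
  apply: (@le_trans _ _ ((expR (- (h * (k.+1%:R * e))))%:E * P (slice X e k))).
    rewrite -[(k.+1)%:R%R]nat1r mulrDl mul1r mulrDr opprD expRD EFinM -muleA.
    by rewrite lee_wpmul2l ?lee_fin ?expR_ge0//; exact: ge_integral_slice.
  by rewrite lee_wpmul2r// Yh.
apply: le_measure; rewrite ?inE.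
- apply: measurableI; last exact: measurable_slice.
  exact/measurable_sublevel/mY/ltW.
- by apply: measurableI; [exact: measurable_sublevel|exact: measurable_slice].
- move=> w [/= Yw Xw]; split=> //=; apply: le_trans Yw; apply: ndY => //.
  by move: Xw; rewrite /slice /= in_itv /= => /andP[_ /ltW].
Qed.

End time_change_df.

(** Independence of the processes, in the form used by the slicing argument. *)
Lemma independent_processes_le d (Omega : measurableType d) (R : realType)
    (P : probability Omega R) (Y : R -> Omega -> \bar R) (T : R -> Omega -> R)
    (s t x : R) (B : set R) :
  independent_processes P Y T -> (0 <= s)%R -> (0 <= t)%R -> measurable B ->
  P ([set w | Y t w <= x%:E] `&` T s @^-1` B) =
  P [set w | Y t w <= x%:E] * P (T s @^-1` B).
Proof.
move=> YT s0 t0 mB; apply: YT; apply: sub_sigma_algebra.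
  exists t => //; exists `]-oo, x%:E]%classic; first exact: emeasurable_itv.
  by rewrite setTI; apply/seteqP; split=> w /=; rewrite in_itv.
by exists s => //; exists B => //; rewrite setTI.
Qed.

Theorem theorem3p2 (d : measure_display) (Omega : measurableType d)
    (R : realType) (P : probability Omega R)
    (beta : R) (H : R -> \bar R)
    (Y : R -> Omega -> \bar R) (T : R -> Omega -> R) :
  (0 < beta)%R ->
  (forall x : R, (0 <= H x)%E) ->
  distribution_function (fun x : R => expeR (- H x)%E) ->
  extremal_process P Y ->
  homogeneous_max_increments P Y (fun x : R => expeR (- H x)%E) ->
  compounding_process P Y T ->
  G_gamma P beta (T 1%R) ->
  G_gamma_MID P beta H (time_change Y T).
Proof.
move=> beta0 H0 _ [mY ndY rcY _] Yhom [mT T0 _ _ YT] [mT1 _ lapT].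
have {}T0 w : (0 <= T 1%R w)%R by exact: T0.
have mYT := measurable_time_change mY ndY rcY mT1 T0.
split=> // x; rewrite /time_change.
have indep t y B : (0 <= t)%R -> measurable B ->
    P ([set w | Y t w <= y%:E] `&` T 1%R @^-1` B) =
    P [set w | Y t w <= y%:E] * P (T 1%R @^-1` B).
  exact: independent_processes_le.
have lap h : (0 <= h)%R ->
    laplace_transform P (T 1%R) h = ((1 + beta * ln (1 + h))^-1)%:E.
  by move=> h0; rewrite lapT// ln_powR div1r.
have Ydf t : (0 < t)%R -> P [set w | Y t w <= x%:E] = expeR (- H x) `^ t.
  by move=> t0; rewrite (Yhom t t0).2.
rewrite /G_gamma_MID_df div1e.
move: (H0 x) Ydf; case: (H x) => [h|//|//] /=.
  rewrite lee_fin => h0 Ydf.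
  have h1 : (0 < 1 + h)%R by rewrite ltr_wpDr.
  have lnh : (0 <= ln (1 + h))%R by rewrite ln_ge0// lerDl.
  rewrite leNgt h1 /= -EFinM -EFinD inver gt_eqF; last first.
    by rewrite ltr_wpDr// mulr_ge0// ltW.
  have {}Ydf t : (0 < t)%R -> P [set w | Y t w <= x%:E] = (expR (- (h * t)))%:E.
    by move=> t0; rewrite Ydf// -mulNr expRM.
  rewrite -lap//; apply/eqP; rewrite eq_le; apply/andP; split.
    apply: time_change_df_le_laplace => // t; rewrite le_eqVlt => /predU1P[<-|t0].
      by rewrite mulr0 oppr0 expR0 probability_le1//; exact/measurable_sublevel/mY.
    by rewrite Ydf.
  by apply: time_change_df_ge_laplace => // t t0; rewrite Ydf.
(* Where H x is infinite, P (Y t <= x) = 0 for t > 0, hence at most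
   exp (- h t) for all h, and P (Y (T 1) <= x) is at most the transform of T 1
   at every h; the latter tends to 0 as h tends to infinity. *)
move=> _ Ydf; rewrite gt0_muley ?lte_fin// addey// invey.
apply/eqP; rewrite eq_le measure_ge0 andbT; apply/lee_addgt0Pr => e e0.
rewrite add0e.
(* The transform at h = exp (1 / (beta e)) is at most e. *)
set h := expR (beta * e)^-1; have h0 : (0 < h)%R by exact: expR_gt0.
apply: (@le_trans _ _ (laplace_transform P (T 1%R) h)).
  apply: time_change_df_le_laplace => //; first exact: ltW.
  move=> t; rewrite le_eqVlt => /predU1P[<-|t0].
    by rewrite mulr0 oppr0 expR0 probability_le1//; exact/measurable_sublevel/mY.
  by rewrite Ydf//= powR0 ?gt_eqF// lee_fin expR_ge0.
have lnh : ((beta * e)^-1 <= ln (1 + h))%R.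
  by rewrite -[leLHS]expRK ler_ln ?posrE ?addr_gt0// lerDr.
rewrite lap ?(ltW h0)// lee_fin -[leRHS]invrK lef_pV2 ?posrE ?invr_gt0//.
  apply: (@le_trans _ _ (beta * ln (1 + h))%R); last by rewrite lerDr.
  by rewrite -ler_pdivrMl// -invfM.
rewrite ltr_pwDl// mulr_ge0 ?(ltW beta0)// (le_trans _ lnh)// invr_ge0.
by rewrite mulr_ge0// ltW.
Qed.
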